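(* Let $G$ be a connected triangle-free graph on $n$ vertices. Then $t(G) \geq \sqrt{n}$, where $t(G)$ denotes the maximum number of vertices in an induced subgraph of $G$ that is a tree.
   Context: All graphs are finite and simple. For a graph $G$, $t(G)$ is the maximum number of vertices of an induced subgraph of $G$ which is a tree. A graph is triangle-free if it contains no three pairwise adjacent vertices. *)

(* Defs.v *)
From mathcomp Require Import all_boot all_order all_algebra.

Set Implicit Arguments.
Unset Strict Implicit.
Unset Printing Implicit Defensive.

Record sgraph := SGraph {
  vertex :> finType;
  adj : rel vertex;
  adj_sym : symmetric adj;
  adj_irr : irreflexive adj }.

Definition triangle_free (G : sgraph) : Prop :=
  forall x y z : G, ~ [/\ adj x y, adj y z & adj x z].

(* The null graph is not connected, hence not a tree. *)
Definition connected_graph (G : sgraph) : bool :=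
  (0 < #|vertex G|) && [forall x : G, forall y : G, connect (@adj G) x y].

(* A cycle repeats no vertex, so its length is at most #|vertex G|; this bound
   only serves to make the predicate boolean (see acyclicP). Lengths below 3
   are excluded since ucycleb also holds of [::] and of both ends of an edge. *)
Definition acyclic (G : sgraph) : bool :=
  [forall k : 'I_(#|vertex G|).+1, forall c : k.-tuple G,
     (2 < k) ==> ~~ ucycleb (@adj G) c].

Lemma acyclicP (G : sgraph) :
  reflect (forall c : seq G, 2 < size c -> ~ ucycle (@adj G) c) (acyclic G).
Proof.
apply: (iffP forallP) => [H c c3 cc | H k].
  have /andP[_ uc] : ucycleb (@adj G) c := cc.
  have sc : size c < (#|vertex G|).+1 by rewrite ltnS -(card_uniqP uc) max_card.
  have /forallP/(_ (in_tuple c))/implyP/(_ c3)/negP := H (Ordinal sc).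
  by apply.
apply/forallP => c; apply/implyP => k3; apply/negP; apply: H.
by rewrite size_tuple.
Qed.

Definition is_tree (G : sgraph) : bool := connected_graph G && acyclic G.

Section Induced.
Variables (G : sgraph) (S : {set G}).

Definition induced_adj : rel {x : G | x \in S} :=
  fun x y => adj (val x) (val y).

Lemma induced_adj_sym : symmetric induced_adj.
Proof. by move=> x y; apply: adj_sym. Qed.

Lemma induced_adj_irr : irreflexive induced_adj.
Proof. by move=> x; apply: adj_irr. Qed.

Definition induced : sgraph := SGraph induced_adj_sym induced_adj_irr.

End Induced.

Definition max_induced_tree (G : sgraph) : nat :=
  \max_(S : {set G} | is_tree (induced S)) #|vertex (induced S)|.

(* Main.v *)
(** Fix a root [r]; by induction, a connected vertex set [U] contains an induced
    tree [T] through [r] with [#|U| - 1 <= (#|T| - 1)^2].  The components of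
    [U] minus the closed neighbourhood of [r], of sizes [b_i], define a hypergraph
    on the neighbours of [r], the [i]-th edge being the set of neighbours touching
    the component.  Choose a set [S] of neighbours; they are pairwise nonadjacent
    since there is no triangle.  A component touched by exactly one [s] in [S]
    extends the tree through [s] by at least [sqrt b_i] vertices, independently of
    the other components.  The bound thus reduces to a statement on weighted
    hypergraphs: some [S] has private weight at least the square root of the sum
    of the squared weights. *)
Require Import Defs.
From mathcomp Require Import all_boot all_order all_algebra.
From mathcomp Require Import zify.

Set Implicit Arguments.
Unset Strict Implicit.
Unset Printing Implicit Defensive.

(** * Comparison of finite sums *)

Lemma sum_sqr_le_sqr_sum (I : finType) (P : pred I) (F : I -> nat) :
  \sum_(i | P i) F i ^ 2 <= (\sum_(i | P i) F i) ^ 2.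
Proof.
elim/big_rec2: _ => // i x y _ le_xy; nia.
Qed.

Lemma leq_sum_subpred (I : finType) (P Q : pred I) (F : I -> nat) :
  (forall i, P i -> F i != 0 -> Q i) -> \sum_(i | P i) F i <= \sum_(i | Q i) F i.
Proof.
move=> PQ; rewrite [X in X <= _]big_mkcond [X in _ <= X]big_mkcond /=.
apply: leq_sum => i _; case: ifP => // Pi; case: ifP => // /negbT nQ.
by rewrite leqNgt; apply: contra nQ; rewrite lt0n; apply: PQ.
Qed.

(** * Private weights in weighted hypergraphs *)

Section WeightedHypergraph.

Variable A : finType.
Implicit Types (w : {set A} -> nat) (S T X Y Z : {set A}).

Definition private_weight w T := \sum_(Z : {set A} | #|Z :&: T| == 1) w Z.

Lemma private_weight1 w a :
  private_weight w [set a] = \sum_(Z : {set A} | a \in Z) w Z.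
Proof.
apply: eq_bigl => Z; case: (boolP (a \in Z)) => aZ.
  by rewrite (setIidPr _) ?cards1 ?sub1set.
by rewrite setIC disjoint_setI0 ?cards0 // disjoints1.
Qed.

Lemma private_weightT w : \sum_a w [set a] <= private_weight w setT.
Proof.
rewrite -(big_imset w (h := set1) (A := predT)) /=; last first.
  by move=> a b _ _ /set1_inj.
apply: leq_sum_subpred => Z /imsetP[a _ ->] _.
by rewrite setIT cards1.
Qed.

(** One factor of each [w Z ^ 2] is replaced by the sum of the singleton weights in [Z]; then the
    order of summation is exchanged. *)
Lemma sum_sqr_singletons w (P : pred {set A}) :
  (forall Z, P Z -> w Z <= \sum_(a in Z) w [set a]) ->
  \sum_(Z : {set A} | P Z) w Z ^ 2 <= \sum_a w [set a] * \sum_(Z : {set A} | P Z && (a \in Z)) w Z.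
Proof.
move=> wle; apply: (@leq_trans (\sum_(Z : {set A} | P Z) \sum_(a in Z) w [set a] * w Z)).
  apply: leq_sum => Z PZ; rewrite -big_distrl /= -mulnn leq_mul2r wle //.
  by rewrite orbT.
rewrite (exchange_big_dep predT) //=.
by apply: leq_sum => a _; rewrite big_distrr.
Qed.

(** The push-forward of [w] under intersection with [S]: sets that become equal after deleting the
    points outside [S] are merged and their weights added. *)
Definition trace w S X := \sum_(Z : {set A} | Z :&: S == X) w Z.

Lemma private_weight_trace w S T :
  private_weight (trace w S) T = private_weight w (S :&: T).
Proof.
rewrite /private_weight /trace.
rewrite [RHS](partition_big (fun Z => Z :&: S) (fun X => #|X :&: T| == 1)) /=.
  apply: eq_bigr => X PX; apply: eq_bigl => Z.
  case: (Z :&: S =P X) => [eqX|]; rewrite ?andbF // andbT setIA eqX.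
  by rewrite PX.
by move=> Z; rewrite setIA.
Qed.

(* If no set is heavier than the singletons it contains, either all points or
   a single point will do.  Otherwise a minimal heavy set Y is collapsed to the
   one of its points with the largest private weight inside Y. *)
Lemma private_weight_sqr w :
  exists T, \sum_(Z : {set A} | Z != set0) w Z ^ 2 <= private_weight w T ^ 2.
Proof.
(* Induction on the size of a set [S] of points supporting [w], since collapsing a heavy set deletes
   points. *)
suff gen k S : #|S| <= k -> (forall Z, w Z != 0 -> Z \subset S) ->
    exists T, \sum_(Z : {set A} | Z != set0) w Z ^ 2 <= private_weight w T ^ 2.
  by apply: (gen _ setT (leqnn _)) => Z _; apply: subsetT.
elim: k S w => [|k IHk] S w.
  rewrite leqn0 cards_eq0 => /eqP-> w0; exists set0.
  rewrite big1 // => Z Z0; apply/eqP; rewrite expn_eq0 andbT.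
  by apply: contraNT Z0 => /w0; rewrite subset0.
move=> cS wS.
pose heavy Z := (Z != set0) && (\sum_(a in Z) w [set a] < w Z).
case: (pickP heavy) => [Y1 hY1 | light]; last first.
  have /sum_sqr_singletons le_sum Z :
      Z != set0 -> w Z <= \sum_(a in Z) w [set a].
    by move=> Z0; have := light Z; rewrite /heavy Z0 ltnNge => /negbFE.
  set p := \sum_a w [set a].
  (* If no point has degree above [p], all points together suffice. Otherwise [a0] also shows that
     [A] is inhabited, so a maximal degree [m] exists; the squares sum to at most [p * m], hence to
     at most the square of the larger factor. *)
  case: (pickP (fun a : A => p < \sum_(Z : {set A} | a \in Z) w Z)) => [a0 _ | small].
    case: (@arg_maxnP A a0 predT (fun a => \sum_(Z : {set A} | a \in Z) w Z)) => // a _ amax.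
    set m := \sum_(Z : {set A} | a \in Z) w Z in amax.
    have le_pm : \sum_(Z : {set A} | Z != set0) w Z ^ 2 <= p * m.
      apply: leq_trans le_sum _; rewrite /p big_distrl /=.
      apply: leq_sum => b _; rewrite leq_mul2l; apply/orP; right.
      apply: leq_trans (amax b isT); apply: leq_sum_subpred => Z.
      by case/andP.
    case: (leqP p m) => [pm | mp].
      exists [set a]; rewrite private_weight1 -/m; nia.
    exists setT; have := private_weightT w; rewrite -/p; nia.
  exists setT; apply: leq_trans le_sum _.
  apply: (@leq_trans (p ^ 2)); last by rewrite leq_sqr private_weightT.
  rewrite -mulnn {1}/p big_distrl /=.
  apply: leq_sum => b _; rewrite leq_mul2l; apply/orP; right.
  apply: leq_trans (_ : \sum_(Z : {set A} | b \in Z) w Z <= _); last first.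
    by rewrite leqNgt; apply/negbT/small.
  by apply: leq_sum_subpred => Z; case/andP.
have [Y /minsetP[/andP[Y0 hY] minY] _] := minset_exists hY1.
(* By minimality of [Y], the singleton estimate holds strictly inside [Y]. *)
have lightY Z : (Z != set0) && (Z \proper Y) -> w Z <= \sum_(a in Z) w [set a].
  case/andP=> Z0 ZY; rewrite leqNgt; apply/negP => hZ.
  have := minY Z; rewrite /heavy Z0 hZ (proper_sub ZY) => /(_ isT isT) eqZ.
  by rewrite eqZ properxx in ZY.
have YS : Y \subset S by apply: wS; lia.
pose q a := \sum_(Z : {set A} | (Z \proper Y) && (a \in Z)) w Z.
have [a1 a1Y] := set0Pn _ Y0.
case: (@arg_maxnP A a1 (mem Y) q) => // a /= aY amax.
(* Of the points of [Y] only [a], which maximizes [q], survives. *)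
pose S' := S :\: (Y :\ a).
have aS' : a \in S' by rewrite !inE eqxx (subsetP YS).
have cS' : #|S'| <= k.
  (* A heavy set is not a singleton, so at least one point is really deleted. *)
  have [b bY ba] : exists2 b, b \in Y & b != a.
    apply/exists_inP; apply: contraLR hY => /exists_inPn Ya.
    have -> : Y = [set a].
      apply/setP=> x; rewrite inE; apply/idP/eqP => [xY|->//].
      by apply/eqP; have := Ya x xY; rewrite negbK.
    by rewrite big_set1 ltnn.
  rewrite -ltnS; apply: leq_trans cS; apply: proper_card.
  apply/properP; split; first by apply: subsetDl.
  by exists b; rewrite ?(subsetP YS) // !inE ba bY.
have trS' X : trace w S' X != 0 -> X \subset S'.
  apply: contraNT => XS'; rewrite /trace big1 // => Z /eqP ZX.
  by rewrite -ZX subsetIr in XS'.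
have [T HT] := IHk S' (trace w S') cS' trS'.
exists (S' :&: T); rewrite -private_weight_trace; apply: leq_trans HT.
(* The sets inside [Y] are charged to the trace [[set a]], all others to the remaining nonempty
   traces. *)
rewrite [X in _ <= X](bigD1 [set a]) /=; last by apply/set0Pn; exists a; rewrite inE.
rewrite [X in X <= _](bigID (fun Z => Z \subset Y)) /=; apply: leq_add.
  have qle : w Y + q a <= trace w S' [set a].
    rewrite /trace (bigD1 Y) /=; last first.
      apply/eqP/setP=> x; rewrite !inE; case: eqP => [->|_] /=.
        by rewrite aY (subsetP YS).
      by case: (x \in Y).
    rewrite leq_add2l; apply: leq_sum_subpred => Z /andP[ZY aZ] _.
    rewrite (proper_neq ZY) andbT; apply/eqP/setP=> x; rewrite !inE.
    case: eqP => [->|_] /=; first by rewrite aZ (subsetP YS).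
    case xZ: (x \in Z) => //=; first by rewrite (subsetP (proper_sub ZY)).
  apply: (@leq_trans ((w Y + q a) ^ 2)); last by rewrite leq_sqr.
  rewrite (bigD1 Y) ?Y0 ?subxx //=.
  have -> : \sum_(Z : {set A} | (Z != set0) && (Z \subset Y) && (Z != Y)) w Z ^ 2 =
            \sum_(Z : {set A} | (Z != set0) && (Z \proper Y)) w Z ^ 2.
    by apply: eq_bigl => Z; rewrite properEneq -andbA [(Z \subset Y) && _]andbC.
  have le1 := sum_sqr_singletons lightY.
  have le2 : \sum_b w [set b] * \sum_(Z : {set A} | (Z != set0) && (Z \proper Y) && (b \in Z)) w Z
       <= (\sum_(b in Y) w [set b]) * q a.
    rewrite big_distrl /= [X in _ <= X]big_mkcond /=; apply: leq_sum => b _.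
    case: ifP => bY.
      rewrite leq_mul2l; apply/orP; right; apply: leq_trans (amax b bY).
      by apply: leq_sum_subpred => Z /andP[/andP[_ ->]->].
    rewrite big1 ?muln0 // => Z /andP[/andP[_ /proper_sub/subsetP ZY] /ZY].
    by rewrite bY.
  (* As [Y] is heavy, [le1] and [le2] bound the squares strictly inside [Y] by [w Y * q a], which is
     at most the cross term of [(w Y + q a) ^ 2]. *)
  nia.
apply: (@leq_trans (\sum_(X : {set A} | (X != set0) && (X != [set a]))
                      \sum_(Z : {set A} | Z :&: S' == X) w Z ^ 2)); last first.
  by apply: leq_sum => X _; apply: sum_sqr_le_sqr_sum.
have -> : \sum_(X : {set A} | (X != set0) && (X != [set a])) \sum_(Z : {set A} | Z :&: S' == X) w Z ^ 2
  = \sum_(Z : {set A} | (Z :&: S' != set0) && (Z :&: S' != [set a])) w Z ^ 2.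
  rewrite [RHS](partition_big (fun Z => Z :&: S')
    (fun X => (X != set0) && (X != [set a]))) //=.
  apply: eq_bigr => X PX; apply: eq_bigl => Z.
  by case: (Z :&: S' =P X) => [->|]; rewrite ?andbF // PX.
(* A set of nonzero weight not inside [Y] keeps a point outside [Y], so its trace is neither empty
   nor [[set a]]. *)
apply: leq_sum_subpred => Z /andP[Z0 ZY] wZ.
have ZS : Z \subset S by apply: wS; apply: contraNneq wZ => ->.
have [z zZ zY] := subsetPn ZY.
have zI : z \in Z :&: S' by rewrite !inE zZ (negbTE zY) andbF (subsetP ZS).
apply/andP; split; first by apply/set0Pn; exists z.
by apply: contraNneq zY => eqa; rewrite eqa inE in zI; rewrite (eqP zI).
Qed.

End WeightedHypergraph.

(** Indices with the same set [N i] are merged by adding their weights, which can only increase the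
    sum of squares. This allows several components to touch the same neighbours. *)
Lemma private_weight_indexed (A I : finType) (P : pred I) (N : I -> {set A})
    (t : I -> nat) :
  (forall i, P i -> N i != set0) ->
  exists T : {set A},
    \sum_(i | P i) t i ^ 2 <= (\sum_(i | P i && (#|N i :&: T| == 1)) t i) ^ 2.
Proof.
move=> N0; pose w X := \sum_(i | P i && (N i == X)) t i.
have [T HT] := private_weight_sqr w; exists T.
have -> : \sum_(i | P i && (#|N i :&: T| == 1)) t i = private_weight w T.
  rewrite (partition_big N (fun X => #|X :&: T| == 1)) /= => [|i /andP[]//].
  apply: eq_bigr => X X1; apply: eq_bigl => i.
  by case: (N i =P X) => [->|]; rewrite ?andbF // X1 !andbT.
apply: leq_trans HT; rewrite (partition_big N (fun X => X != set0)) //=.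
by apply: leq_sum => X _; apply: sum_sqr_le_sqr_sum.
Qed.

(** * Invariants along paths and rounded-up square roots *)

Lemma connect_inv (T : finType) (e : rel T) (P : T -> Prop) x y :
  connect e x y -> P x -> (forall u v, P u -> e u v -> P v) -> P y.
Proof.
move=> /connectP[p]; elim: p x => [|z p IHp] x /=; first by move=> _ ->.
by case/andP=> exz pp yE Px Pe; apply: IHp pp yE (Pe _ _ Px exz) Pe.
Qed.

Lemma sqrt_up_ex n : exists k, n <= k ^ 2.
Proof. by exists n; rewrite -mulnn; nia. Qed.

Definition sqrt_up n := ex_minn (sqrt_up_ex n).

Lemma sqrt_upP n : n <= sqrt_up n ^ 2.
Proof. by rewrite /sqrt_up; case: ex_minnP. Qed.

Lemma sqrt_up_min n k : n <= k ^ 2 -> sqrt_up n <= k.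
Proof. by rewrite /sqrt_up; case: ex_minnP => m _; apply. Qed.

(** * Induced trees grown leaf by leaf *)

Section InducedTrees.

Variable G : sgraph.
Implicit Types (x y z r s : G) (T U B : {set G}).

(** Each new vertex has exactly one neighbour in the set built so far, so the induced subgraph stays
    a tree, and tree properties follow by induction on leaves. *)
Inductive grown_tree r : {set G} -> Prop :=
| grown_root : grown_tree r [set r]
| grown_leaf T x y : grown_tree r T -> x \notin T -> y \in T -> adj x y ->
    (forall z, z \in T -> adj x z -> z = y) -> grown_tree r (x |: T).

Lemma grown_tree_root r T : grown_tree r T -> r \in T.
Proof.
elim=> [|{}T x y _ rT _ _ _ _]; first exact: set11.
by rewrite inE rT orbT.
Qed.

(** The leaves of [T2] are added to [T1] in their original order. A new leaf sees no vertex of [T1]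
    except possibly [s], which already belongs to the grown part of [T2], so its neighbour stays
    unique. *)
Lemma grown_tree_glue r s T1 T2 :
  grown_tree r T1 -> s \in T1 -> grown_tree s T2 ->
  (forall x, x \in T1 -> x \in T2 -> x = s) ->
  (forall x y, x \in T1 -> y \in T2 -> x != s -> y != s -> ~~ adj x y) ->
  grown_tree r (T1 :|: T2).
Proof.
move=> tT1 sT1; elim=> [|T x y tT IH xT yT axy y_uniq] meet cross.
  by rewrite setUC (setUidPr _) // sub1set.
have xs : x != s by apply: contraNneq xT => ->; apply: grown_tree_root.
have sub z : z \in T -> z \in x |: T by rewrite inE orbC => ->.
have xT1 : x \notin T1.
  by apply: contra xs => xT1; apply/eqP; apply: meet; rewrite ?setU11.
rewrite setUCA; apply: (@grown_leaf _ _ x y) => //.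
- apply: IH => [z zT1 /sub/(meet _ zT1) // | z z' zT1 /sub z'T].
  exact: cross.
- by rewrite inE (negbTE xT1).
- by rewrite inE yT orbT.
move=> z; rewrite inE => /orP[zT1|]; last exact: y_uniq.
case: (eqVneq z s) => [-> | zs axz].
  by apply: y_uniq; apply: grown_tree_root.
by have := cross z x zT1 (setU11 _ _) zs xs; rewrite adj_sym axz.
Qed.

Lemma grown_tree_star r (s : seq G) :
  r \notin s -> uniq s -> {in s, forall x, adj r x} ->
  {in s &, forall x y, ~~ adj x y} -> grown_tree r (r |: [set x in s]).
Proof.
elim: s => [|x s IHs] /= rs us rx sx.
  have -> : r |: [set x in [::]] = [set r] by apply/setP=> z; rewrite !inE orbF.
  exact: grown_root.
move: rs us; rewrite inE negb_or => /andP[rx' rs] /andP[xs us].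
rewrite set_cons setUCA.
apply: (@grown_leaf _ _ x r); rewrite ?setU11 //.
- apply: IHs => // [y ys | y z ys zs]; first by apply: rx; rewrite inE ys orbT.
  by apply: sx; rewrite inE ?ys ?zs orbT.
- by rewrite !inE negb_or eq_sym rx' xs.
- by rewrite adj_sym rx // mem_head.
move=> z; rewrite !inE => /predU1P[//|zs] axz.
by have := sx x z; rewrite !inE eqxx zs orbT axz => /(_ isT isT).
Qed.

(** * Grown trees are connected and acyclic *)

Definition adj_in U : rel G := fun x y => [&& x \in U, y \in U & adj x y].

Lemma adj_in_sym U : symmetric (adj_in U).
Proof. by move=> x y; rewrite /adj_in adj_sym andbCA. Qed.

Definition connected_from r U := forall x, x \in U -> connect (adj_in U) r x.

Lemma grown_tree_connected r T : grown_tree r T -> connected_from r T.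
Proof.
elim=> [x | {}T x y _ IH xT yT axy _ z]; first by rewrite inE => /eqP->.
have conT u : u \in T -> connect (adj_in (x |: T)) r u.
  move=> /IH; apply: connect_sub => a b /and3P[aT bT ab].
  by apply: connect1; rewrite /adj_in !inE aT bT ab !orbT.
rewrite in_setU1 => /predU1P[->|/conT //].
apply: connect_trans (conT _ yT) (connect1 _).
by rewrite /adj_in !inE eqxx yT orbT adj_sym.
Qed.

Lemma grown_tree_acyclic r T (c : seq G) :
  grown_tree r T -> {subset c <= T} -> 2 < size c -> ~ ucycle (@adj G) c.
Proof.
move=> tT; elim: tT c => [|{}T x y _ IH xT yT axy y_uniq] c cT c3.
  case/andP=> _ uc; have: size c <= size [:: r].
    by apply: uniq_leq_size => // z /cT; rewrite !inE.
  by rewrite leqNgt (ltn_trans _ c3).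
case: (boolP (x \in c)) => [xc | xc]; last first.
  apply: IH c3 => z zc; have := cT z zc; rewrite in_setU1 => /predU1P[zx|//].
  by rewrite -zx zc in xc.
(* Rotated to start at the last leaf [x], the cycle has [x] between its second and its last vertex.
   Both must be the unique neighbour [y], yet they are distinct. *)
have [i p rotc] := rot_to xc; rewrite -(rot_ucycle i) rotc.
have sp : size p = (size c).-1 by rewrite -(size_rot i c) rotc.
have pT z : z \in x :: p -> z != x -> z \in T.
  by rewrite -rotc mem_rot => /cT; rewrite in_setU1 => /predU1P[->|//]; rewrite eqxx.
case: p sp pT {rotc} => [|a [|b p]] sp pT; try by (move: c3 sp => /=; lia).
case/andP=> /=; rewrite rcons_path => /and4P[axa _ _ alx].
rewrite !inE !negb_or => /andP[/and3P[xa xb xp] /andP[/andP[ab ap] _]].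
have lp : last b p \in b :: p by apply: mem_last.
have lx : last b p != x.
  by apply: contraTneq lp => ->; rewrite inE negb_or xb.
have aE : a = y by apply: y_uniq => //; apply: pT; rewrite ?inE ?eqxx ?orbT // eq_sym.
have lE : last b p = y.
  apply: y_uniq; last by rewrite adj_sym.
  by apply: pT => //; rewrite 2!inE lp !orbT.
by move: lp; rewrite lE -aE inE (negbTE ab) (negbTE ap).
Qed.

Lemma grown_tree_is_tree r T : grown_tree r T -> is_tree (induced T).
Proof.
move=> tT; have rT := grown_tree_root tT.
apply/andP; split; last first.
  apply/acyclicP => c c3 /andP[cc uc].
  apply: (grown_tree_acyclic (c := map val c) tT).
  - by move=> _ /mapP[z _ ->]; apply: valP.
  - by rewrite size_map.
  apply/andP; split; last by rewrite (map_inj_uniq val_inj).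
  by rewrite cycle_map.
have from_r (x : induced T) : connect (@adj (induced T)) (Sub r rT) x.
  case: x => y yT; move: (yT).
  apply: (connect_inv (P := fun z => forall zT : z \in T,
    connect (@adj (induced T)) (Sub r rT) (Sub z zT)) (grown_tree_connected tT yT)).
    by move=> rT'; rewrite (bool_irrelevance rT' rT).
  move=> u v cu /and3P[uT vT auv] vT'.
  exact: connect_trans (cu uT) (connect1 _).
apply/andP; split; first by apply/card_gt0P; exists (Sub r rT).
apply/forallP=> x; apply/forallP=> y; apply: connect_trans (from_r y).
by rewrite (sym_connect_sym (@adj_sym _)).
Qed.

Lemma grown_tree_max r T : grown_tree r T -> #|T| <= max_induced_tree G.
Proof.
move=> /grown_tree_is_tree tT; rewrite -[#|T|]card_sig.
exact: (@leq_bigmax_cond _ _ (fun S => #|vertex (induced S)|)).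
Qed.

(** * The rooted tree bound *)

(* Each component [B] of [U] minus the closed neighbourhood of [r] is given the
   weight [sqrt_up #|B|], attached to the neighbours of [r] that it touches; each
   neighbour of [r] has weight 1.  Trees grown by induction into the components
   seeing exactly one chosen neighbour do not interact. *)
Theorem rooted_tree_sqr r U :
  triangle_free G -> r \in U -> connected_from r U ->
  exists T, [/\ grown_tree r T, T \subset U & #|U|.-1 <= #|T|.-1 ^ 2].
Proof.
move=> tf; have [k] := ubnP #|U|; elim: k => // k IHk in r U *.
rewrite ltnS => cU rU conU.
pose A := [set a in U | adj r a].
pose W := [set x in U | (x != r) && ~~ adj r x].
pose R := connect (adj_in W).
have symR : connect_sym (adj_in W) by apply: sym_connect_sym; apply: adj_in_sym.
pose CP := equivalence_partition R W.
have partCP : partition CP W.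
  apply: equivalence_partitionP => x y z _ _ _; split; first exact: connect0.
  by move=> Rxy; apply: (same_connect symR).
have [_ trivCP _] := and3P partCP.
have CP_R B x y : B \in CP -> x \in B -> y \in W -> (y \in B) = R x y.
  case/imsetP=> z zW ->; rewrite !inE => /andP[_ zx] yW.
  by rewrite yW /R -(same_connect symR zx).
have CP_W B x : B \in CP -> x \in B -> x \in W.
  by case/imsetP=> z zW ->; rewrite inE => /andP[].
have CP_neq B B' x : B \in CP -> B' \in CP -> x \in B -> x \in B' -> B = B'.
  move=> BP B'P xB xB'; apply/eqP; apply: contraTT xB' => /(trivIsetP trivCP _ _ BP B'P).
  by move=> /disjointFr->.
have CP_adj B x y : B \in CP -> x \in B -> y \in W -> adj x y -> y \in B.
  move=> BP xB yW axy; rewrite (CP_R _ _ _ BP xB yW); apply: connect1.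
  by rewrite /adj_in yW axy (CP_W B).
pose NB B := [set a in A | [exists b in B, adj a b]].
have NB0 B : B \in CP -> NB B != set0.
  move=> BP; apply/negP=> /eqP NB0.
  have [x xB] : exists x, x \in B.
    by case/imsetP: (BP) => z zW ->; exists z; move: zW; rewrite !inE => ->; apply: connect0.
  have: x \notin B; last by rewrite xB.
  have xU : x \in U by have := CP_W _ _ BP xB; rewrite inE => /andP[].
  (* If no neighbour of [r] touched [B], a path in [U] starting at [r] could never enter [B]. *)
  apply: (connect_inv (P := fun y => y \notin B) (conU _ xU)).
    by apply/negP=> /(CP_W _ _ BP); rewrite !inE eqxx andbF.
  move=> u v uB /and3P[uU vU auv]; apply: contra uB => vB.
  have vW := CP_W _ _ BP vB.
  case: (boolP (u \in A)) => [uA | uA].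
    have : u \in NB B by rewrite inE uA; apply/exists_inP; exists v.
    by rewrite NB0 inE.
  have ur : u != r.
    by apply: contraTneq vW => ur; rewrite inE -ur auv !andbF.
  apply: CP_adj (vB) _ _; rewrite ?[adj v u]adj_sym // inE uU ur.
  by move: uA; rewrite inE uU.
(* Hyperedges are indexed by a disjoint union: [inl a] pays for the vertex [a] itself, [inr B] for
   the part of the tree inside [B]. *)
pose N (i : G + {set G}) := match i with inl a => [set a] | inr B => NB B end.
pose P (i : G + {set G}) := match i with inl a => a \in A | inr B => B \in CP end.
pose t (i : G + {set G}) := match i with inl a => 1 | inr B => sqrt_up #|B| end.
have PN i : P i -> N i != set0.
  by case: i => [a _ | B /NB0 //]; apply/set0Pn; exists a; apply: set11.
have [S0] := private_weight_indexed t PN.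
rewrite !big_sumType /= => HS0.
pose S := A :&: S0.
have SA x : x \in S -> x \in A by rewrite inE => /andP[].
have rA : r \notin A by rewrite inE adj_irr andbF.
have starT : grown_tree r (r |: S).
  have := @grown_tree_star r (enum S); rewrite set_enum mem_enum; apply.
  - by apply: contra rA => /SA.
  - exact: enum_uniq.
  - by move=> x; rewrite mem_enum => /SA; rewrite inE => /andP[].
  move=> x y; rewrite !mem_enum => /SA + /SA; rewrite !inE.
  move=> /andP[_ rx] /andP[_ ry]; apply/negP=> axy.
  by apply: (tf r x y).
pose Q B := (B \in CP) && (#|NB B :&: S0| == 1).
(* Starting from the star on [r] and [S], the components with a unique chosen neighbour are
   processed one at a time; the third clause keeps the tree away from components not yet used. *)
have grow (bs : seq {set G}) : uniq bs -> all Q bs ->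
  exists T, [/\ grown_tree r T, r |: S \subset T,
    forall x, x \in T -> x \in r |: S \/ (exists2 B, B \in bs & x \in B) &
    #|S|.+1 + \sum_(B <- bs) sqrt_up #|B| <= #|T|].
  elim: bs => [|B bs IH] /=.
    move=> _ _; exists (r |: S); split=> //; first by left.
    by rewrite big_nil addn0 cardsU1 (contra (@SA r) rA).
  case/andP=> Bbs ubs /andP[/andP[BP /cards1P[s NBs]] allQ].
  have [T [tT rST Tsub cT]] := IH ubs allQ.
  have : s \in NB B :&: S0 by rewrite NBs set11.
  rewrite 2!inE => /andP[/andP[sA /exists_inP[b bB asb]] sS0].
  have sS : s \in S by rewrite inE sA.
  have sT : s \in T by apply: (subsetP rST); rewrite inE sS orbT.
  have sB : s \notin B.
    apply/negP=> /(CP_W _ _ BP); move: sA; rewrite !inE.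
    by move=> /andP[_ ->]; rewrite !andbF.
  have BU x : x \in B -> x \in U by move/(CP_W _ _ BP); rewrite inE => /andP[].
  have sBU : s |: B \subset U :\ r.
    apply/subsetP=> x; rewrite !inE => /predU1P[->|xB].
      move: sA; rewrite inE => /andP[-> rs]; rewrite andbT.
      by apply: contraTneq rs => ->; rewrite adj_irr.
    by have := CP_W _ _ BP xB; rewrite inE => /and3P[-> -> _].
  have csB : #|s |: B| < k.
    apply: leq_ltn_trans (subset_leq_card sBU) _.
    by rewrite (cardsD1 r U) rU in cU.
  have consB : connected_from s (s |: B).
    move=> x; rewrite in_setU1 => /predU1P[->|xB]; first exact: connect0.
    have bx : R b x by rewrite -(CP_R B) // (CP_W B).
    pose reached y := y \in B /\ connect (adj_in (s |: B)) s y.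
    suff [] : reached x by [].
    apply: (connect_inv bx); rewrite /reached.
      by split=> //; apply: connect1; rewrite /adj_in !inE eqxx bB orbT.
    move=> u v [uB cu] /and3P[uW vW auv].
    have vB : v \in B by apply: CP_adj auv.
    split=> //; apply: connect_trans cu (connect1 _).
    by rewrite /adj_in !inE uB vB !orbT.
  (* The induction is rerooted at [s]; the set [s |: B] is smaller than [U] because it misses
     [r]. *)
  have [T2 [tT2 T2sub]] := IHk s (s |: B) csB (setU11 _ _) consB.
  rewrite cardsU1 sB /= => /sqrt_up_min cT2.
  have T2B x : x \in T2 -> x != s -> x \in B.
    by move=> /(subsetP T2sub); rewrite in_setU1 => /predU1P[->|//]; rewrite eqxx.
  have meet x : x \in T -> x \in T2 -> x = s.
    move=> xT xT2; apply/eqP; apply/negPn/negP=> xs.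
    have xB := T2B _ xT2 xs; have xW := CP_W _ _ BP xB.
    case: (Tsub _ xT) => [|[B' B'bs xB']].
      rewrite in_setU1 => /predU1P[xr | /SA]; move: xW; rewrite !inE.
        by rewrite xr eqxx andbF.
      by case/and3P=> _ _ /negbTE->; rewrite andbF.
    have /andP[B'P _] := allP allQ _ B'bs.
    by rewrite (CP_neq B B' x) ?B'bs in Bbs.
  exists (T :|: T2); split.
  - apply: (grown_tree_glue tT sT tT2 meet) => x y xT yT2 xs ys.
    have yB := T2B _ yT2 ys; have yW := CP_W _ _ BP yB.
    apply/negP=> axy; case: (Tsub _ xT) => [|[B' B'bs xB']].
      rewrite in_setU1 => /predU1P[xr | xS].
        by move: yW; rewrite inE -xr axy !andbF.
      have : x \in NB B :&: S0.
        move: xS; rewrite !inE => /andP[-> ->]; rewrite andbT.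
        by apply/exists_inP; exists y.
      by rewrite NBs inE (negbTE xs).
    have /andP[B'P _] := allP allQ _ B'bs.
    have yB' := CP_adj _ _ _ B'P xB' yW axy.
    by rewrite (CP_neq B B' y) ?B'bs in Bbs.
  - exact: subset_trans rST (subsetUl _ _).
  - move=> x; rewrite inE => /orP[/Tsub[|[B' B'bs xB']]|xT2]; first by left.
      by right; exists B'; rewrite // inE B'bs orbT.
    case: (eqVneq x s) => [->|xs]; first by left; rewrite inE sS orbT.
    by right; exists B; rewrite ?mem_head // T2B.
  (* The two trees share only [s], so gluing adds [#|T2| - 1], at least [sqrt_up #|B|], vertices. *)
  have meet1 : #|T :&: T2| <= 1.
    rewrite -(cards1 s); apply: subset_leq_card; apply/subsetP=> x.
    by rewrite !inE => /andP[xT xT2]; rewrite (meet x).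
  have T2_gt0 : 0 < #|T2|.
    by apply/card_gt0P; exists s; apply: grown_tree_root.
  rewrite big_cons; move: (cardsUI T T2) meet1 T2_gt0 cT2 cT.
  move: #|T :|: T2| #|T :&: T2| #|T| #|T2| #|S| (sqrt_up _) (\sum_(_ <- _) _).
  by clear; lia.
have [|T [tT _ Tsub cT]] := grow (enum [pred B | Q B]) (enum_uniq _).
  by apply/allP=> B; rewrite mem_enum.
exists T; split=> //.
  apply/subsetP=> x /Tsub[|[B]].
    by rewrite in_setU1 => /predU1P[->|/SA]; rewrite // inE => /andP[].
  by rewrite mem_enum => /andP[BP _] /(CP_W _ _ BP); rewrite inE => /andP[].
rewrite big_enum /= in cT.
have cUE : #|U|.-1 = #|A| + #|W|.
  rewrite (cardsD1 r U) rU add1n /= -(cardsID A (U :\ r)); congr (_ + _).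
    apply: eq_card => x; rewrite !inE.
    case: (x =P r) => [->|_] /=; first by rewrite adj_irr andbF.
    by case: (x \in U).
  apply: eq_card => x; rewrite !inE; case: (x \in U) => //=; last by rewrite !andbF.
  by rewrite andbT andbC.
have leS : \sum_(a | (a \in A) && (#|[set a] :&: S0| == 1)) 1 <= #|S|.
  rewrite sum1_card; apply: subset_leq_card; apply/subsetP=> a.
  rewrite unfold_in => /andP[aA /cards1P[b bE]].
  have : b \in [set a] :&: S0 by rewrite bE set11.
  by rewrite in_setI in_set1 => /andP[/eqP-> aS0]; rewrite in_setI aA.
have leW : #|W| <= \sum_(B in CP) sqrt_up #|B| ^ 2.
  by rewrite (card_partition partCP); apply: leq_sum => B _; apply: sqrt_upP.
have AE : \sum_(a in A) 1 ^ 2 = #|A| by rewrite -sum1_card.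
rewrite cUE; apply: leq_trans (_ : _ <= #|A| + \sum_(B in CP) sqrt_up #|B| ^ 2) _.
  by rewrite leq_add2l.
rewrite -AE; apply: leq_trans HS0 _; rewrite leq_sqr.
(* The extra one in [#|S|.+1] is the root, which the bound on [#|T|.-1] leaves out. *)
rewrite -ltnS; apply: leq_trans (leqSpred _); apply: leq_trans cT.
by rewrite addSn ltnS leq_add.
Qed.

End InducedTrees.

(** * The square root bound over a real closed field *)

Local Open Scope ring_scope.
Import Order.TTheory GRing.Theory Num.Theory.

Theorem theorem1p1 (R : rcfType) (G : sgraph) (n : nat) :
  connected_graph G -> triangle_free G -> #|vertex G| = n ->
  Num.sqrt (n%:R : R) <= (max_induced_tree G)%:R.
Proof.
case/andP=> /card_gt0P[r _] /forallP/(_ r)/forallP conG tf cG.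
have [|||T [tT _ cT]] := @rooted_tree_sqr G r setT => //.
  move=> x _; apply: connect_sub (conG x) => u v auv; apply: connect1.
  by rewrite /adj_in !inE.
have := grown_tree_max tT; rewrite cardsT cG in cT.
have /card_gt0P/= cT0 : exists x, x \in T by exists r; apply: grown_tree_root.
(* As [#|T|] is positive, [(#|T| - 1)^2 + 1 <= #|T|^2], which absorbs the predecessor of [n] in
   [cT]. *)
move=> leT; have le_n : (n <= max_induced_tree G ^ 2)%N by nia.
rewrite -[leRHS]ger0_norm ?ler0n // -sqrtr_sqr.
by rewrite ler_wsqrtr // -natrX ler_nat.
Qed.
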